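(* Let $G$ and $H$ be graphs over the same vertex set $V=\{x_1,\dots,x_n\}$ with edge sets $\{e, e_2, \dots, e_r\}$ and $\{e, e_2', \dots, e'_s\}$, respectively, where $e= \{x_u, x_v\}$ is a common leaf of $G$ and $H$, with $x_v$ being the leaf vertex (so $\deg_G(x_v)=\deg_H(x_v)=1$). Let $(\ell, k_2, \dots, k_r) \in \mathbb{Z}^r_{\ge 0}$ and $(\ell, h_2, \dots, h_s) \in \mathbb{Z}^s_{\ge 0}$ with $\ell \ge k_i$ and $\ell \ge h_j$ for all $i$ and $j$. Suppose that the sequence of shadows $x_{u,1}, \dots, x_{u,\ell}$ of $x_u$ is a decomposing sequence (in the sense defined in the context) in $G(\ell, k_2, \dots, k_r)$ and in $H(\ell, h_2, \dots, h_s)$. Then the sequence of shadows $x_{u,1}, \dots, x_{u,\ell}$ of $x_u$ is also a decomposing sequence in $(G \vee_e H)(\ell, k_2, \dots, k_r, h_2, \dots, h_s)$. In particular, $(G \vee_e H)(\ell, k_2, \dots, k_r, h_2, \dots, h_s)$ is vertex decomposable.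
   Context: All graphs are finite, simple and undirected. An edge of a graph is a leaf if one of its endpoints has degree 1; if $e=\{x,y\}$ is a leaf with $\deg(y)=1$, then $y$ is called a leaf vertex. Gluing: let $G$ and $H$ be graphs over the vertex set $V=\{x_1,\dots,x_n\}$ and let $e=\{x_i,x_j\}$ be a common edge. Let $H'$ be an isomorphic copy of $H$ on the vertex set $\{y_1,\dots,y_n\}$. Then $G\vee_e H$ is obtained from the disjoint union of $G$ and $H'$ by identifying $x_i$ with $y_i$ and $x_j$ with $y_j$. Its edges are $e, e_2,\dots,e_r$ together with the copies in $H'$ of $e_2',\dots,e_s'$; in $(G\vee_e H)(\ell,k_2,\dots,k_r,h_2,\dots,h_s)$ the integers $\ell$, $k_i$, $h_j$ correspond to $e$, $e_i$ and the copy of $e_j'$, respectively. Duplicating the edges: let $\Gamma$ be a graph with vertices $x_1,\dots,x_n$ and edges $e_1,\dots,e_m$. For an edge $e=\{x_i,x_j\}$ and an integer $r \ge 0$, set $V(e(r)) = \{x_{t,p} \mid t \in \{i,j\},\ 1\le p\le r\}$ and $E(e(r)) = \{\{x_{i,p},x_{j,q}\} \mid p,q\ge 1,\ p+q\le r+1\}$. For $(k_1,\dots,k_m)\in \mathbb Z_{\ge 0}^m$, $\Gamma(k_1,\dots,k_m)$ is the graph with vertex set $\bigcup_{i=1}^m V(e_i(k_i))$ and edge set $\bigcup_{i=1}^m E(e_i(k_i))$. The vertices $x_{i,p}$ are called the shadows of $x_i$. For a vertex $x$ of a graph $\Gamma$, $N_\Gamma[x] = \{x\}\cup\{y \mid \{x,y\}\in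 E_\Gamma\}$; for $U \subseteq V_\Gamma$, $\Gamma\setminus U$ is the induced subgraph on $V_\Gamma \setminus U$. A vertex $x$ is a shedding vertex of $\Gamma$ if no independent set in $\Gamma\setminus N_\Gamma[x]$ is a maximal independent set in $\Gamma\setminus x$. A graph $\Gamma$ is vertex decomposable if either $\Gamma$ consists of isolated vertices (no edges), or there is a shedding vertex $x$ of $\Gamma$ such that both $\Gamma\setminus x$ and $\Gamma\setminus N_\Gamma[x]$ are vertex decomposable. Decomposing sequence (a name used here for a set of conditions): a sequence $z_1,\dots,z_m$ of vertices of a graph $\Gamma$ is a decomposing sequence in $\Gamma$ if, setting $\Psi_0=\Gamma$, $\Psi_i=\Psi_{i-1}\setminus z_i$ and $\Omega_i=\Psi_{i-1}\setminus N_{\Psi_{i-1}}[z_i]$ for $1\le i\le m$, the following hold: (a) $z_i$ is a shedding vertex of $\Psi_{i-1}$ for all $1\le i\le m$; (b) $\Omega_i$ is vertex decomposable for all $1\le i\le m$; (c) $\Psi_m$ is vertex decomposable. *)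

(* Defs.v *)
From mathcomp Require Import all_boot.
From mathcomp Require Import finmap.

Set Implicit Arguments.
Unset Strict Implicit.
Unset Printing Implicit Defensive.

Local Open Scope fset_scope.

(* The vertices are labelled by elements of K and an edge is the set of its
   two endpoints. *)
Record graph (K : choiceType) := Graph {
  vertices : {fset K};
  edges : {fset {fset K}};
  edges_wf : all (fun f : {fset K} => (f `<=` vertices) && (#|` f| == 2))
                 edges
}.

Section Graphs.
Variable K : choiceType.
Implicit Types (G : graph K) (x y : K) (S U : {fset K}).

Definition degree G x : nat := #|` [fset f in edges G | x \in f]|.

(* e is a leaf of G with leaf vertex y *)
Definition leaf G (e : {fset K}) y : Prop :=
  [/\ e \in edges G, y \in e & degree G y = 1].

Definition closed_nbhd G x : {fset K} :=
  x |` [fset y in vertices G | [fset x; y] \in edges G].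

Lemma remove_wf G U :
  all (fun f : {fset K} => (f `<=` vertices G `\` U) && (#|` f| == 2))
      [fset f in edges G | f `<=` vertices G `\` U].
Proof.
apply/allP => f; rewrite !inE /= => /andP[fE fV]; rewrite fV /=.
by have /allP/(_ f fE)/andP[] := edges_wf G.
Qed.

Definition remove G U : graph K := Graph (remove_wf G U).

Definition independent G S : Prop :=
  S `<=` vertices G /\
  {in S &, forall x y, [fset x; y] \notin edges G}.

Definition maximal_independent G S : Prop :=
  independent G S /\
  forall S', independent G S' -> S `<=` S' -> S' = S.

Definition shedding G x : Prop :=
  x \in vertices G /\
  forall S, independent (remove G (closed_nbhd G x)) S ->
            ~ maximal_independent (remove G [fset x]) S.

(* The graph without vertices is vertex decomposable. *)
Inductive vertex_decomposable : graph K -> Prop :=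
| VDedgeless G : edges G = fset0 -> vertex_decomposable G
| VDshedding G x :
    shedding G x ->
    vertex_decomposable (remove G [fset x]) ->
    vertex_decomposable (remove G (closed_nbhd G x)) ->
    vertex_decomposable G.

(* Psi G z i deletes the first i vertices of z from G. The sequence z is
   indexed from 0, so that Omega G z i is formed at the (i+1)-st vertex. *)
Definition Psi G (z : seq K) (i : nat) : graph K :=
  foldl (fun G' x => remove G' [fset x]) G (take i z).

Definition Omega G (z : seq K) (i : 'I_(size z)) : graph K :=
  remove (Psi G z i) (closed_nbhd (Psi G z i) (tnth (in_tuple z) i)).

Definition decomposing_sequence G (z : seq K) : Prop :=
  [/\ forall i : 'I_(size z), shedding (Psi G z i) (tnth (in_tuple z) i),
      forall i : 'I_(size z), vertex_decomposable (Omega G i)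
    & vertex_decomposable (Psi G z (size z))].

End Graphs.

Section Duplication.
Variable K : choiceType.
Implicit Types (G : graph K) (e : {fset K}).

(* The shadow x_{t,p} is the pair (t, p), with p >= 1. *)
Definition dup_edge_vertices e (r : nat) : {fset K * nat} :=
  [fset ((t, p) : K * nat) | t in e, p in iota 1 r].

Definition dup_edge_edges e (r : nat) : {fset {fset K * nat}} :=
  [fset [fset a; b] | a in dup_edge_vertices e r, b in dup_edge_vertices e r
                    & (a.1 != b.1) && (a.2 + b.2 <= r.+1)].

(* The integers k_i are given by a function on edges; its values on sets that
   are not edges of G are not used. *)
Definition dup_vertices G (k : {fset K} -> nat) : {fset K * nat} :=
  \bigcup_(e <- edges G) dup_edge_vertices e (k e).

Definition dup_edges G (k : {fset K} -> nat) : {fset {fset K * nat}} :=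
  \bigcup_(e <- edges G) dup_edge_edges e (k e).

Lemma dup_wf G k :
  all (fun f : {fset K * nat} => (f `<=` dup_vertices G k) && (#|` f| == 2))
      (dup_edges G k).
Proof.
apply/allP => f /bigfcupP[e /andP[eE _]] /imfset2P[a aV [b]].
rewrite !inE => /andP[bV /andP[ab _]] ->; apply/andP; split; last first.
  by rewrite cardfs2; have -> : a != b by apply: contraNneq ab => ->.
by apply/fsubsetP => c; rewrite !inE => /orP[] /eqP ->;
  apply/bigfcupP; exists e; rewrite ?eE.
Qed.

Definition dup G (k : {fset K} -> nat) : graph (K * nat)%type :=
  Graph (dup_wf G k).

Definition shadows (x : K) (l : nat) : seq (K * nat) :=
  [seq (x, p) | p <- iota 1 l].

End Duplication.

Section Gluing.
Variable K : choiceType.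
Implicit Types (G H : graph K) (e : {fset K}).

(* In the gluing of G and H along e, vertices of G are tagged by inl. The copy
   of a vertex y of H is tagged by inr, unless y is an endpoint of e, in which
   case it is identified with the vertex inl y. *)
Definition glue_copy e (y : K) : K + K := if y \in e then inl y else inr y.

Definition glue_vertices G H e : {fset K + K} :=
  inl @` vertices G `|` glue_copy e @` vertices H.

Definition glue_edges G H e : {fset {fset K + K}} :=
  [fset inl @` (f : {fset K}) | f in edges G] `|`
  [fset glue_copy e @` (f : {fset K}) | f in edges H].

Lemma glue_copy_inj e : injective (glue_copy e).
Proof.
by move=> x y; rewrite /glue_copy; case: ifP => _; case: ifP => _ // [].
Qed.

Lemma glue_wf G H e :
  all (fun f : {fset K + K} => (f `<=` glue_vertices G H e) && (#|` f| == 2))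
      (glue_edges G H e).
Proof.
apply/allP => f /fsetUP[] /imfsetP[g /= gE ->].
  have /allP/(_ g gE)/andP[gV /eqP g2] := edges_wf G.
  rewrite card_imfset ?g2 ?eqxx ?andbT; last by move=> x y [].
  by apply: fsubset_trans (fsubsetUl _ _); apply: subset_imfset; apply/fsubsetP.
have /allP/(_ g gE)/andP[gV /eqP g2] := edges_wf H.
rewrite card_imfset ?g2 ?eqxx ?andbT; last exact: glue_copy_inj.
by apply: fsubset_trans (fsubsetUr _ _); apply: subset_imfset; apply/fsubsetP.
Qed.

Definition glue G H e : graph (K + K)%type := Graph (glue_wf G H e).

Definition unglue (a : K + K) : K := match a with inl x => x | inr y => y end.

(* k on the edges of G and h on the copies of the edges of H other than e *)
Definition glue_weight G (k h : {fset K} -> nat) (f : {fset K + K}) : nat :=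
  if f \in [fset inl @` (g : {fset K}) | g in edges G]
  then k (unglue @` f) else h (unglue @` f).

End Gluing.

(* Main.v *)
(* Vertex decomposability only depends on adjacency, and it passes to a graph
   whose edges split into two parts without common vertices. The vertex
   x_{v,l+1-i} has x_{u,i} as its only neighbour once x_{u,1}, ..., x_{u,i-1}
   are deleted, so x_{u,i} is a shedding vertex. The neighbours of x_{u,p} are
   among those of x_{u,i} when i < p, so every remaining shadow of x_u, and
   then every remaining shadow of x_v, is isolated in Omega_i; in Psi_l this
   holds because k_i <= l. As only the shadows of x_u and x_v are shared by the
   two glued parts, Omega_i and Psi_l split into those of G and those of H, up
   to isolated vertices. *)
Require Import Defs.
From mathcomp Require Import all_boot.
From mathcomp Require Import finmap.
From mathcomp Require Import zify.

Set Implicit Arguments.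
Unset Strict Implicit.
Unset Printing Implicit Defensive.

Local Open Scope fset_scope.

(** * Adjacency, shedding vertices and decomposing sequences *)

Definition adj (K : choiceType) (G : graph K) (x y : K) : bool :=
  [fset x; y] \in edges G.

Section Adjacency.
Variable K : choiceType.
Implicit Types (G : graph K) (x y : K) (S U : {fset K}).

Lemma adjC G x y : adj G x y = adj G y x.
Proof. by rewrite /adj fsetUC. Qed.

Lemma adj_vertices G x y :
  adj G x y -> [/\ x \in vertices G, y \in vertices G & x != y].
Proof.
move=> xyE; have /allP/(_ _ xyE)/andP[/fsubsetP xyV] := edges_wf G.
by rewrite cardfs2; case: (x == y) => // _; split=> //; apply: xyV;
  rewrite !inE eqxx ?orbT.
Qed.

Lemma edges_adj G f : f \in edges G -> exists x y, f = [fset x; y].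
Proof.
move=> fE; have /allP/(_ _ fE)/andP[_] := edges_wf G.
case: (fset_0Vmem f) => [->|[x xf]]; first by rewrite cardfs0.
rewrite (cardfsD1 x) xf add1n eqSS => /cardfs1P[y fy].
by exists x, y; rewrite -fy fsetD1K.
Qed.

Lemma edgeless_adj G : edges G = fset0 <-> (forall x y, ~~ adj G x y).
Proof.
split=> [E0 x y|noadj]; first by rewrite /adj E0 in_fset0.
apply/fsetP => f; rewrite in_fset0; apply/negbTE/negP => fE.
have [x [y fxy]] := edges_adj fE.
by have := noadj x y; rewrite /adj -fxy fE.
Qed.

Lemma adj_remove G U x y :
  adj (remove G U) x y = [&& adj G x y, x \notin U & y \notin U].
Proof.
rewrite {1}/adj /= !inE /= -/(adj G x y).
have [xyE /=|//] := boolP (adj G x y); have [xV yV _] := adj_vertices xyE.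
rewrite fsubUset !fsub1set !inE xV yV !andbT; reflexivity.
Qed.

Lemma in_closed_nbhd G x y : (y \in closed_nbhd G x) = (y == x) || adj G x y.
Proof.
rewrite !inE /= -/(adj G x y); case: eqP => //= _.
have [/adj_vertices[]|] := boolP (adj G x y); last by rewrite andbF.
by move=> _ ->.
Qed.

Lemma independent_remove G U S :
  independent (remove G U) S <->
  [/\ S `<=` vertices G, [disjoint S & U]%fset
    & {in S &, forall x y, ~~ adj G x y}].
Proof.
rewrite /independent /= fsubsetD; split.
  case=> /andP[SV SU] Sind; split=> // x y xS yS.
  have := Sind x y xS yS; rewrite -/(adj (remove G U) x y) adj_remove.
  by rewrite !(fdisjointP SU) //= !andbT.
case=> SV SU Sind; rewrite SV SU; split=> // x y xS yS.
by rewrite -/(adj (remove G U) x y) adj_remove negb_and Sind.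
Qed.

(** Induction on the number of vertices outside [S]: one with no neighbour in [S] can be added, and
    if there is none then [S] is already maximal. *)
Lemma maximal_independent_above G S : independent G S ->
  exists2 S', S `<=` S' & maximal_independent G S'.
Proof.
have [n] := ubnP #|` vertices G `\` S|; elim: n => // n IHn in S *.
rewrite ltnS => leSn Sind.
have [/hasP[y yV /andP[yS /allP yfree]]|/hasPn nofree] := boolP (has
  (fun y => (y \notin S) && all (fun a => ~~ adj G y a) (enum_fset S))
  (enum_fset (vertices G))).
  have Syind : independent G (y |` S).
    split; first by rewrite fsubUset fsub1set yV; case: Sind.
    move=> a b; rewrite -/(adj G a b) !inE.
    move=> /orP[/eqP->|aS] /orP[/eqP->|bS].
    - by apply/negP => /adj_vertices[_ _]; rewrite eqxx.
    - exact: yfree.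
    - by rewrite adjC; apply: yfree.
    - exact: (proj2 Sind).
  case: (IHn _ _ Syind) => [|S' ySS' S'max].
    apply: leq_trans leSn; apply: fproper_ltn_card.
    apply: (@fsub_proper_trans _ ((vertices G `\` S) `\ y)).
      by apply/fsubsetP => a; rewrite !inE negb_or -andbA.
    by apply: fproperD1; rewrite !inE yS.
  by exists S' => //; apply: fsubset_trans ySS'; apply: fsubsetUr.
exists S => //; split=> // S' S'ind SS'; apply/eqP.
rewrite eqEfsubset SS' andbT.
apply/fsubsetP => y yS'; apply/negPn/negP => yS.
have /nofree : y \in vertices G by apply: (fsubsetP S'ind.1).
rewrite yS /= => /negP; apply; apply/allP => a aS.
by apply: (proj2 S'ind); rewrite // (fsubsetP SS').
Qed.

(* Unlike [shedding], this form only refers to adjacency, so that it is not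
   affected by isolated vertices. *)
Lemma sheddingP G x :
  shedding G x <->
  forall S, {in S &, forall a b, ~~ adj G a b} ->
    {in S, forall a, a \notin closed_nbhd G x} ->
    exists2 y, adj G x y & {in S, forall a, ~~ adj G y a}.
Proof.
split=> [[xV xshed] S0 S0ind S0N|xshed].
  (* [S0] may contain elements that are not vertices, which [independent] forbids. *)
  pose S := [fset a in S0 | a \in vertices G].
  have Sind : independent (remove G (closed_nbhd G x)) S.
    apply/independent_remove; split.
    - by apply/fsubsetP => a; rewrite !inE => /andP[].
    - by apply/fdisjointP => a; rewrite !inE => /andP[/S0N + _]; rewrite !inE.
    - by move=> a b; rewrite !inE => /andP[aS _] /andP[bS _]; apply: S0ind.
  have [M SM [/[dup] Mind /independent_remove[MV MN Mfree] Mmax]] :=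
    maximal_independent_above Sind.
  have [y xy yM] : exists2 y, adj G x y & {in M, forall a, ~~ adj G y a}.
    have [/hasP[y yV /andP[xy /allP yfree]]|/hasPn nofree] := boolP (has
      (fun y => adj G x y && all (fun a => ~~ adj G y a) (enum_fset M))
      (enum_fset (vertices G))); first by exists y.
    (* If every neighbour of [x] has a neighbour in [M], an independent set containing [M] but not
       [x] avoids [closed_nbhd G x], hence equals [M]. So [M] is maximal without [x], against
       shedding. *)
    case: (xshed M Mind); split.
      apply/independent_remove; split=> //.
      rewrite fdisjointX1; apply/negP => xM.
      by have /fdisjointP/(_ x xM) := MN; rewrite in_closed_nbhd eqxx.
    move=> S' /independent_remove[S'V S'x S'free] MS'.
    apply: Mmax => //; apply/independent_remove; split=> //.
    apply/fdisjointP => a aS'; rewrite in_closed_nbhd negb_or; apply/andP; split.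
      by have /fdisjointP/(_ a aS') := S'x; rewrite inE.
    apply/negP => xa; have /nofree : a \in vertices G by apply: (fsubsetP S'V).
    rewrite xa /= => /negP; apply; apply/allP => b bM.
    by apply: S'free => //; apply: (fsubsetP MS').
  exists y => // a aS; apply/negP => /[dup] /adj_vertices[_ aV _]; apply/negP.
  by apply: yM; apply: (fsubsetP SM); rewrite !inE aS.
split=> [|S /independent_remove[SV SN Sfree] [_ Smax]].
  (* The empty set yields a neighbour of [x], so [x] is a vertex. *)
  case: (xshed fset0) => [a b|a|y]; rewrite ?in_fset0 //.
  by move=> /adj_vertices[].
have [a aS|y xy yfree] := xshed S Sfree; first exact: (fdisjointP SN).
have [_ yV x_y] := adj_vertices xy.
(* Adding [y] keeps [S] independent without [x], so maximality puts [y] in [S], which should avoid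
   the neighbours of [x]. *)
have yS : y \in S.
  rewrite -(Smax (y |` S)) ?fsubsetUr ?fset1U1 //; apply/independent_remove.
  split; first by rewrite fsubUset fsub1set yV.
    rewrite fdisjointX1 !inE negb_or x_y; apply/negP => xS.
    by have /fdisjointP/(_ x xS) := SN; rewrite in_closed_nbhd eqxx.
  move=> a b; rewrite !inE => /orP[/eqP->|aS] /orP[/eqP->|bS].
  - by apply/negP => /adj_vertices[_ _]; rewrite eqxx.
  - exact: yfree.
  - by rewrite adjC; apply: yfree.
  - exact: Sfree.
by have /fdisjointP/(_ y yS) := SN; rewrite in_closed_nbhd xy orbT.
Qed.

Lemma shedding_adj G x : shedding G x -> exists y, adj G x y.
Proof.
move=> /sheddingP/(_ fset0) [a b|a|y xy _]; rewrite ?in_fset0 //.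
by exists y.
Qed.

(** A set avoiding [closed_nbhd G x] misses [x], the only neighbour of [y], so the same [y] serves
    for every [S] in [sheddingP]. *)
Lemma shedding_pendant G x y :
  adj G x y -> (forall a, adj G y a -> a = x) -> shedding G x.
Proof.
move=> xy yx; apply/sheddingP => S _ SN; exists y => // a /SN.
by rewrite in_closed_nbhd; apply: contra => /yx ->; rewrite eqxx.
Qed.

Lemma adj_Psi G (z : seq K) i x y :
  adj (Psi G z i) x y = [&& adj G x y, x \notin take i z & y \notin take i z].
Proof.
rewrite /Psi; elim: (take i z) G => [|w s IHs] G /=; first by rewrite andbT.
rewrite IHs adj_remove !inE !negb_or -!andbA.
by case: (adj G x y) (x == w) (y == w) => [] [] [] //=; rewrite ?andbF.
Qed.

Lemma Psi_succ G (z : seq K) (i : 'I_(size z)) :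
  Psi G z i.+1 = remove (Psi G z i) [fset tnth (in_tuple z) i].
Proof.
have [x0 _] : exists x0 : K, true by exists (tnth (in_tuple z) i).
by rewrite /Psi (take_nth x0) // -cats1 foldl_cat (tnth_nth x0).
Qed.

(** Backward induction from the last [Psi] to [Psi G z 0], which is [G]. *)
Lemma decomposing_sequence_decomposable G (z : seq K) :
  decomposing_sequence G z -> vertex_decomposable G.
Proof.
case=> zshed zOmega zPsi.
suff VDPsi n : n <= size z -> vertex_decomposable (Psi G z (size z - n)).
  by have := VDPsi _ (leqnn _); rewrite subnn /Psi take0.
elim: n => [|n IHn] nz; first by rewrite subn0.
have iz : size z - n.+1 < size z by lia.
pose i := Ordinal iz; apply: (VDshedding (zshed i)) (zOmega i).
rewrite -Psi_succ.
have <- : size z - n = (nat_of_ord i).+1 by rewrite /=; lia.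
by apply: IHn; lia.
Qed.

End Adjacency.

(** * Graphs whose edges are covered by the images of two graphs *)

Section Cover.
Variables (K1 K2 K3 : choiceType) (f1 : K1 -> K3) (f2 : K2 -> K3).
Implicit Types (G : graph K1) (H : graph K2) (L : graph K3).

(** Isolated vertices of the three graphs are unconstrained, and the two images may share
    vertices. *)
Definition adj_cover G H L : Prop := forall a b, adj L a b <->
  (exists x y, [/\ a = f1 x, b = f1 y & adj G x y]) \/
  (exists x y, [/\ a = f2 x, b = f2 y & adj H x y]).

(** Only vertices that carry an edge count, so a shared shadow is allowed once it is isolated in one
    of the parts. *)
Definition adj_separated G H : Prop :=
  forall x x' y y', adj G x x' -> adj H y y' -> f1 x <> f2 y.

Lemma adj_cover_remove G H L U1 U2 U :
  adj_cover G H L ->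
  (forall x x', adj G x x' -> (f1 x \in U) = (x \in U1)) ->
  (forall y y', adj H y y' -> (f2 y \in U) = (y \in U2)) ->
  adj_cover (remove G U1) (remove H U2) (remove L U).
Proof.
move=> cov e1 e2 a b; rewrite adj_remove; split.
  case/and3P=> /cov[] [x [y [-> -> xy]]] xU yU; [left|right]; exists x, y.
    have yx : adj G y x by rewrite adjC.
    by split; rewrite // adj_remove xy -(e1 x y) // -(e1 y x) // xU.
  have yx : adj H y x by rewrite adjC.
  by split; rewrite // adj_remove xy -(e2 x y) // -(e2 y x) // xU.
case=> [] [x [y [-> ->]]]; rewrite adj_remove => /and3P[/[dup] xy];
  rewrite adjC => yx; rewrite -?(e1 x y, e1 y x) -?(e2 x y, e2 y x) // => -> ->.
  by rewrite !andbT; apply/cov; left; exists x, y.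
by rewrite !andbT; apply/cov; right; exists x, y.
Qed.

Lemma eq_adj_cover G G' H H' L L' :
  adj G =2 adj G' -> adj H =2 adj H' -> adj L =2 adj L' ->
  adj_cover G H L -> adj_cover G' H' L'.
Proof.
move=> eG eH eL cov a b; rewrite -eL cov.
split=> [] [] [x [y [-> -> xy]]]; [left|right|left|right];
  exists x, y; split=> //.
- by rewrite -eG.
- by rewrite -eH.
- by rewrite eG.
- by rewrite eH.
Qed.

Lemma adj_cover_removel G H L U1 U :
  adj_cover G H L ->
  (forall x x', adj G x x' -> (f1 x \in U) = (x \in U1)) ->
  (forall y y', adj H y y' -> f2 y \notin U) ->
  adj_cover (remove G U1) H (remove L U).
Proof.
move=> cov e1 e2; apply: (@eq_adj_cover _ _ (remove H fset0)) => // [x y|].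
  by rewrite adj_remove !in_fset0 !andbT.
by apply: adj_cover_remove => // y y' /e2/negbTE ->.
Qed.

Lemma adj_separated_removel G H U1 :
  adj_separated G H -> adj_separated (remove G U1) H.
Proof.
by move=> sep x x' y y'; rewrite adj_remove => /and3P[xx' _ _]; apply: sep xx'.
Qed.

End Cover.

(** * Vertex decomposability of a union of two separated parts *)

Section Union.
Variables (K1 K2 K3 : choiceType) (f1 : K1 -> K3) (f2 : K2 -> K3).
Implicit Types (G : graph K1) (H : graph K2) (L : graph K3).
Hypothesis f1_inj : injective f1.

(** By separation, the image of a non-isolated vertex of [G] is adjacent in [L] only to images of
    its neighbours in [G]. So shedding at [x] and both deletions concern the part of [G] alone. *)
Lemma shedding_union G H L x :
    adj_cover f1 f2 G H L -> adj_separated f1 f2 G H ->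
  shedding G x ->
  [/\ shedding L (f1 x),
    adj_cover f1 f2 (remove G [fset x]) H
      (remove L [fset f1 x]) &
    adj_cover f1 f2 (remove G (closed_nbhd G x)) H
      (remove L (closed_nbhd L (f1 x)))].
Proof.
move=> cov sep xshed; have [x0 xx0] := shedding_adj xshed.
have adj1 y y' b : adj G y y' -> adj L (f1 y) b ->
    exists2 z, b = f1 z & adj G y z.
  move=> yy' /cov[] [a [c []]]; first by move=> /f1_inj<- -> ya; exists c.
  by move=> e2 _ ac; case: (sep _ _ _ _ yy' ac e2).
have adj1E y y' z : adj G y y' -> adj L (f1 y) (f1 z) = adj G y z.
  move=> yy'; apply/idP/idP => [/(adj1 _ _ _ yy')[w /f1_inj-> //]|yz].
  by apply/cov; left; exists y, z.
split.
- apply/sheddingP => S Sind SN.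
  (* The free neighbour is sought in [G], for the preimage of [S]. *)
  pose S1 := [fset a in vertices G | f1 a \in S].
  have /sheddingP/(_ S1) := xshed; case.
  + move=> a b; rewrite !inE => /andP[_ aS] /andP[_ bS].
    by have := Sind _ _ aS bS; apply: contra => ab; rewrite (adj1E a b).
  + move=> a; rewrite inE => /andP[_ /SN]; rewrite !in_closed_nbhd.
    by rewrite (inj_eq f1_inj) (adj1E x x0).
  + move=> y xy yfree; exists (f1 y); first by rewrite (adj1E x x0).
    move=> a aS; apply/negP; rewrite adjC in xy => /(adj1 _ _ _ xy)[z az yz].
    have /yfree : z \in S1; last by rewrite yz.
    by rewrite !inE -az aS; case/adj_vertices: yz => _ ->.
- apply: adj_cover_removel => // [y y' _|y y' yy'].
    by rewrite !inE (inj_eq f1_inj).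
  rewrite !inE; apply/eqP => /esym; exact: sep xx0 yy'.
- apply: adj_cover_removel => // [y y' _|y y' yy'].
    by rewrite !in_closed_nbhd (inj_eq f1_inj) (adj1E x x0).
  (* By separation, a non-isolated vertex from [H] is neither [f1 x] nor the image of a neighbour of
     [x]. *)
  rewrite in_closed_nbhd; apply/negP => /orP[/eqP/esym|].
    exact: sep xx0 yy'.
  case/(adj1 _ _ _ xx0) => z /esym; rewrite adjC in xx0 *.
  move=> e2 xz; rewrite adjC in xz; exact: sep xz yy' e2.
Qed.

End Union.

Lemma adj_cover_sym (K1 K2 K3 : choiceType) (f1 : K1 -> K3)
    (f2 : K2 -> K3) G H L :
  adj_cover f1 f2 G H L -> adj_cover f2 f1 H G L.
Proof.
by move=> cov a b; rewrite cov; split=> -[]; [right|left|right|left].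
Qed.

Lemma adj_separated_sym (K1 K2 K3 : choiceType) (f1 : K1 -> K3)
    (f2 : K2 -> K3) G H :
  adj_separated f1 f2 G H -> adj_separated f2 f1 H G.
Proof. by move=> sep x x' y y' xx' yy' /esym; apply: sep yy' xx'. Qed.

(** Nested induction: first on the decomposition of [G], whose shedding vertices also shed in [L];
    once [G] is edgeless, on that of [H] with the two parts exchanged; in the end [L] has no
    edge. *)
Lemma vertex_decomposable_union (K1 K2 K3 : choiceType) (f1 : K1 -> K3)
    (f2 : K2 -> K3) G H L :
    injective f1 -> injective f2 ->
    adj_cover f1 f2 G H L -> adj_separated f1 f2 G H ->
  vertex_decomposable G -> vertex_decomposable H -> vertex_decomposable L.
Proof.
move=> f1_inj f2_inj cov sep VDG VDH.
elim: VDG L cov sep => {G} [G /edgeless_adj G0|G x xshed _ IHx _ IHN] L cov sep.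
  elim: VDH L cov sep => {H} [H /edgeless_adj H0|H x xshed _ IHx _ IHN].
    move=> L cov _.
    apply: VDedgeless; apply/edgeless_adj => a b; apply/negP => /cov.
    by case=> [] [x [y [_ _]]]; apply/negP.
  move=> L /adj_cover_sym cov /adj_separated_sym sep.
  have [/VDshedding] := shedding_union f2_inj cov sep xshed.
  move=> VDL /adj_cover_sym/IHx {}IHx /adj_cover_sym/IHN {}IHN.
  by apply: VDL; [apply: IHx|apply: IHN];
    apply/adj_separated_sym/adj_separated_removel.
have [/VDshedding VDL /IHx {}IHx /IHN {}IHN] :=
  shedding_union f1_inj cov sep xshed.
by apply: VDL; [apply: IHx|apply: IHN]; apply: adj_separated_removel.
Qed.

(** * Adjacency after duplication of the edges *)

Lemma edge_pair (K : choiceType) (G : graph K) f x y :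
  f \in edges G -> x \in f -> y \in f -> x != y -> f = [fset x; y].
Proof.
move=> fE xf yf xy; have /allP/(_ _ fE)/andP[_ /eqP f2] := edges_wf G.
apply/esym/eqP; rewrite eqEfcard fsubUset !fsub1set xf yf f2 cardfs2 xy; reflexivity.
Qed.

Lemma in_dup_edge_vertices (K : choiceType) (e : {fset K}) r a :
  (a \in dup_edge_vertices e r) = (a.1 \in e) && (0 < a.2 <= r).
Proof.
apply/imfset2P/idP => [[t te [p]]|/andP[ae ar]].
  by rewrite /= mem_iota => pr -> /=; rewrite te; lia.
case: a => t p in ae ar *; exists t => //; exists p => //.
by rewrite /= mem_iota; move: ar => /=; lia.
Qed.

(** The upper bound on each single index is implied by the bound on the sum, as the other index is
    positive. *)
Lemma adj_dup (K : choiceType) (G : graph K) k a b :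
  adj (dup G k) a b = [&& adj G a.1 b.1, 0 < a.2, 0 < b.2
    & a.2 + b.2 <= (k [fset a.1; b.1]).+1].
Proof.
apply/idP/idP => [|/and4P[ab a0 b0 abk]].
  case/bigfcupP=> e /andP[eE _] /imfset2P[c cV [d]].
  rewrite !inE => /andP[dV /andP[c_d cdk]] abcd.
  move: cV dV; rewrite /= !in_dup_edge_vertices => /andP[ce cr] /andP[de dr].
  have eE' := edge_pair eE ce de c_d.
  (* Equality of unordered pairs leaves two matchings of the ends. *)
  suff [[-> ->]|[-> ->]] : (a = c /\ b = d) \/ (a = d /\ b = c).
  - by rewrite /adj -eE' eE cdk; case/andP: cr dr => -> _ /andP[->].
  - by rewrite /adj (fsetUC [fset d.1]) -eE' eE addnC cdk;
      case/andP: cr dr => -> _ /andP[->].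
  have : a \in [fset c; d] by rewrite -abcd fset21.
  have : b \in [fset c; d] by rewrite -abcd fset22.
  have : c \in [fset a; b] by rewrite abcd fset21.
  have : d \in [fset a; b] by rewrite abcd fset22.
  rewrite !inE => d_ab c_ab b_cd /pred2P[ac|ad]; case/pred2P: b_cd => [bc|bd].
  - by left; move: d_ab; rewrite ac bc orbb => /eqP->.
  - by left.
  - by right.
  - by left; move: c_ab; rewrite ad bd orbb => /eqP->.
apply/bigfcupP; exists [fset a.1; b.1]; first by rewrite andbT.
case: a b => [t p] [s q] /= in ab a0 b0 abk *.
apply/imfset2P; exists (t, p).
  by rewrite /= in_dup_edge_vertices fset21 /=; lia.
exists (s, q) => //; rewrite !inE in_dup_edge_vertices fset22 /= abk.
by case/adj_vertices: ab => _ _ ->; lia.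
Qed.

(** * Gluing and its compatibility with duplication *)

Section GluedDuplication.
Variable K : choiceType.
Implicit Types (G H : graph K) (e : {fset K}).

Lemma adj_glue G H e : adj_cover inl (glue_copy e) G H (glue G H e).
Proof.
move=> A B; split=> [AB|].
  have [_ _ A_B] := adj_vertices AB.
  have preimage (g : K -> K + K) (F : graph K) (f : {fset K}) :
      f \in edges F -> [fset A; B] = g @` f ->
      exists x y, [/\ A = g x, B = g y & adj F x y].
    move=> fE ABf.
    have : A \in [fset A; B] by rewrite fset21.
    have : B \in [fset A; B] by rewrite fset22.
    rewrite ABf => /imfsetP[y /= yf By] /imfsetP[x /= xf Ax].
    exists x, y; split=> //; rewrite /adj -(edge_pair fE xf yf) //.
    by apply: contraNneq A_B => xy; rewrite Ax By xy.
  by case/fsetUP: AB => /imfsetP[f /= fE ABf]; [left|right];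
    apply: preimage ABf.
case=> [] [x [y [-> -> xy]]]; apply/fsetUP; [left|right];
  by apply/imfsetP; exists [fset x; y]; rewrite //= imfset_fset2.
Qed.

Lemma glue_copy_inl e x y : glue_copy e x = inl y -> x = y /\ y \in e.
Proof. by rewrite /glue_copy; case: ifP => // xe [<-]. Qed.

(** An edge from [H] with both ends in the image of [inl] has its ends in [e], so it is [e] itself,
    which is also an edge of [G]. *)
Lemma adj_glue_inl G H e x y :
  e \in edges G -> adj (glue G H e) (inl x) (inl y) = adj G x y.
Proof.
move=> eG; apply/idP/idP => [xy|xy]; last by apply/adj_glue; left; exists x, y.
have [_ _ x_y] := adj_vertices xy; case/adj_glue: xy => [] [x' [y' []]].
  by case=> -> [->].
move=> /esym/glue_copy_inl[_ xe] /esym/glue_copy_inl[_ ye] _.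
by rewrite /adj -(edge_pair eG xe ye).
Qed.

Lemma adj_glue_copy G H e x y :
  e \in edges H -> adj (glue G H e) (glue_copy e x) (glue_copy e y) = adj H x y.
Proof.
move=> eH; apply/idP/idP => [xy|xy]; last by apply/adj_glue; right; exists x, y.
have [_ _ x_y] := adj_vertices xy; case/adj_glue: xy => [] [x' [y' []]].
  move=> /glue_copy_inl[xx' xe] /glue_copy_inl[yy' ye] _; subst x' y'.
  by rewrite /adj -(edge_pair eH xe ye) //; apply: contraNneq x_y => ->.
by move=> /glue_copy_inj-> /glue_copy_inj->.
Qed.

Definition dup_inl (a : K * nat) : (K + K) * nat := (inl a.1, a.2).
Definition dup_copy e (a : K * nat) : (K + K) * nat := (glue_copy e a.1, a.2).

Lemma dup_inl_inj : injective dup_inl.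
Proof. by move=> [x p] [y q] [-> ->]. Qed.

Lemma dup_copy_inj e : injective (dup_copy e).
Proof. by move=> [x p] [y q] [/glue_copy_inj -> ->]. Qed.

Lemma glue_weight_inl G (k h : {fset K} -> nat) x y : adj G x y ->
  glue_weight G k h [fset inl x; inl y] = k [fset x; y].
Proof.
move=> xy; rewrite /glue_weight imfset_fset2 /=.
case: ifP => // /negP[]; apply/imfsetP; exists [fset x; y] => //=.
by rewrite imfset_fset2.
Qed.

Lemma glue_copyK e : cancel (glue_copy e) (@unglue K).
Proof. by move=> x; rewrite /glue_copy; case: ifP. Qed.

(** [glue_weight] takes [k] if the copied edge is also the image of an edge of [G]; both its ends
    then lie in [e], so it is [e], where [k] and [h] agree. *)
Lemma glue_weight_copy G H e (k h : {fset K} -> nat) x y :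
  e \in edges H -> k e = h e -> adj H x y ->
  glue_weight G k h [fset glue_copy e x; glue_copy e y] = h [fset x; y].
Proof.
move=> eE khe xy; have [_ _ x_y] := adj_vertices xy.
rewrite /glue_weight imfset_fset2 /= !glue_copyK.
case: ifP => // /imfsetP[f /= _ xyf].
have in_e z : glue_copy e z \in [fset glue_copy e x; glue_copy e y] -> z \in e.
  by rewrite xyf => /imfsetP[w /= _]; rewrite /glue_copy; case: ifP.
by rewrite -(edge_pair eE _ _ x_y) // in_e ?fset21 ?fset22.
Qed.

Lemma adj_dup_glue G H e (k h : {fset K} -> nat) :
  e \in edges H -> k e = h e ->
  adj_cover dup_inl (dup_copy e) (dup G k) (dup H h)
    (dup (glue G H e) (glue_weight G k h)).
Proof.
move=> eE khe [A p] [B q]; rewrite adj_dup /=; split.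
  case/and4P => /adj_glue[] [x [y [-> -> xy]]] p0 q0.
    rewrite (glue_weight_inl k h xy) => pq; left; exists (x, p), (y, q).
    by split; rewrite // adj_dup /= xy p0 q0.
  rewrite (glue_weight_copy G eE khe xy) => pq; right; exists (x, p), (y, q).
  by split; rewrite // adj_dup /= xy p0 q0.
case=> [] [[x p'] [[y q'] [[-> ->] [-> ->]]]];
  rewrite adj_dup /= => /and4P[xy -> -> pq].
  rewrite (glue_weight_inl k h xy) pq !andbT.
  by apply/adj_glue; left; exists x, y.
rewrite (glue_weight_copy G eE khe xy) pq !andbT.
by apply/adj_glue; right; exists x, y.
Qed.

(** [adj_cover] leaves open which part an edge comes from. Comparing closed neighbourhoods needs an
    equality within one part, even at the shared shadows. *)
Lemma adj_dup_glue_inl G H e (k h : {fset K} -> nat) a b :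
  e \in edges G ->
  adj (dup (glue G H e) (glue_weight G k h)) (dup_inl a) (dup_inl b) =
  adj (dup G k) a b.
Proof.
move=> eG; rewrite !adj_dup /= adj_glue_inl //.
by have [ab|//] := boolP (adj G _ _); rewrite glue_weight_inl.
Qed.

Lemma adj_dup_glue_copy G H e (k h : {fset K} -> nat) a b :
  e \in edges H -> k e = h e ->
  adj (dup (glue G H e) (glue_weight G k h)) (dup_copy e a) (dup_copy e b) =
  adj (dup H h) a b.
Proof.
move=> eH khe; rewrite !adj_dup /= adj_glue_copy //.
by have [ab|//] := boolP (adj H _ _); rewrite (glue_weight_copy G eH).
Qed.

End GluedDuplication.

Arguments dup_inl {K} a.

(** * Sequences of shadows and the neighbours of the leaf vertex *)

Section Shadows.
Variable K : choiceType.
Implicit Types (G H : graph K) (F : graph (K * nat)%type).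

Lemma in_shadows (x : K) l a :
  (a \in shadows x l) = (a.1 == x) && (0 < a.2 <= l).
Proof.
case: a => t p; apply/mapP/andP => /= [[q]|[/eqP-> pl]].
  by rewrite mem_iota => ql [-> ->]; rewrite eqxx; split=> //; lia.
by exists p => //; rewrite mem_iota; lia.
Qed.

Lemma take_shadows (x : K) l i : i <= l -> take i (shadows x l) = shadows x i.
Proof. by move=> il; rewrite -map_take take_iota (minn_idPl il). Qed.

(** Positions start at 0 and shadows at 1, hence [(x, i.+1)] at position [i]. *)
Lemma decomposing_sequence_shadows F (x : K) l :
  decomposing_sequence F (shadows x l) <->
  [/\ forall i, i < l -> shedding (Psi F (shadows x l) i) (x, i.+1),
      forall i, i < l -> vertex_decomposable (remove (Psi F (shadows x l) i)
        (closed_nbhd (Psi F (shadows x l) i) (x, i.+1)))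
    & vertex_decomposable (Psi F (shadows x l) l)].
Proof.
have sz : size (shadows x l) = l by rewrite size_map size_iota.
have tnthE (i : 'I_(size (shadows x l))) :
    tnth (in_tuple (shadows x l)) i = (x, i.+1).
  have il : i < l by rewrite -{2}sz.
  by rewrite (tnth_nth (x, 0)) (nth_map 0) ?size_iota ?nth_iota.
split=> [] [shed dec decl]; split.
- move=> i il; have isz : i < size (shadows x l) by rewrite sz.
  by have := shed (Ordinal isz); rewrite tnthE.
- move=> i il; have isz : i < size (shadows x l) by rewrite sz.
  by have := dec (Ordinal isz); rewrite /Omega tnthE.
- by move: decl; rewrite sz.
- by move=> i; rewrite tnthE; apply: shed; rewrite -{2}sz.
- by move=> i; rewrite /Omega tnthE; apply: dec; rewrite -{2}sz.
- by rewrite sz.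
Qed.

Lemma leaf_adj G (u v x : K) : leaf G [fset u; v] v -> adj G v x -> x = u.
Proof.
case=> uvE _ /eqP/cardfs1P[f0 deg] vx; have [_ _ v_x] := adj_vertices vx.
have f0E f : f \in edges G -> v \in f -> f = f0.
  by move=> fE vf; apply/fset1P; rewrite -deg !inE fE.
have : x \in [fset u; v].
  by rewrite (f0E _ uvE) ?fset22 // -(f0E _ vx) ?fset21 // fset22.
by rewrite !inE => /orP[/eqP//|/eqP xv]; rewrite xv eqxx in v_x.
Qed.

Lemma leaf_dup_adj G k (u v : K) q a : leaf G [fset u; v] v ->
  adj (dup G k) (v, q) a ->
  [/\ a.1 = u, 0 < a.2 & a.2 + q <= (k [fset u; v]).+1].
Proof.
move=> leafG; rewrite adj_dup /= => /and4P[/(leaf_adj leafG) -> _ a0].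
by rewrite (fsetUC [fset v]) addnC.
Qed.

(** A remaining [(u, p)] has [i.+1 < p]. If [(w, q)] is adjacent to it, then [i.+1 + q] also meets
    the bound on the sum, so [(w, q)] was deleted as a neighbour of [(u, i.+1)]. *)
Lemma Omega_shadow_isolated G k (u : K) l i p b : i < l ->
  ~~ adj (remove (Psi (dup G k) (shadows u l) i)
            (closed_nbhd (Psi (dup G k) (shadows u l) i) (u, i.+1))) (u, p) b.
Proof.
move=> il; rewrite adj_remove !in_closed_nbhd !adj_Psi.
rewrite take_shadows ?(ltnW il) //.
case: b => w q; apply/and3P; rewrite !in_shadows !adj_dup /= eqxx /=.
case=> /andP[/and4P[uw p0 q0 pq] /andP[pi wi]].
rewrite negb_or xpair_eqE eqxx /= => /andP[p_i _].
by rewrite negb_or uw wi q0 ltnn /= => /andP[_]; lia.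
Qed.

(** Only shadows of [u] and [v] are shared. Those of [u] are isolated in [F] by hypothesis; those of
    [v] can only be adjacent to shadows of [u], so they are isolated too. *)
Lemma leaf_separated G F F' k (u v : K) :
  leaf G [fset u; v] v ->
  (forall a b, adj F a b -> adj (dup G k) a b) ->
  (forall p b, ~~ adj F (u, p) b) ->
  adj_separated dup_inl (dup_copy [fset u; v]) F F'.
Proof.
move=> leafG FG uF [t p] [t' p'] [s q] y' xx' _ [+ _]; rewrite /= /glue_copy.
case: ifP => // + [ts]; rewrite -{s}ts !inE => /orP[] /eqP tE; subst t.
  by have := uF p (t', p'); rewrite xx'.
have := FG _ _ xx'; rewrite adj_dup => /= /and4P[/(leaf_adj leafG) t'u _ _ _].
by have := uF p' (v, p); rewrite adjC -t'u xx'.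
Qed.

End Shadows.

(** * Transfer of the decomposing sequence to the glued graph *)

Theorem theorem4p3 (K : choiceType) (G H : graph K) (u v : K) (l : nat)
    (k h : {fset K} -> nat)
    (same_vertices : vertices G = vertices H)
    (leafG : leaf G [fset u; v] v) (leafH : leaf H [fset u; v] v)
    (ke : k [fset u; v] = l) (he : h [fset u; v] = l)
    (k_le : forall f, f \in edges G -> k f <= l)
    (h_le : forall f, f \in edges H -> h f <= l)
    (decG : decomposing_sequence (dup G k) (shadows u l))
    (decH : decomposing_sequence (dup H h) (shadows u l)) :
  decomposing_sequence
    (dup (glue G H [fset u; v]) (glue_weight G k h))
    (shadows (inl u) l) /\
  vertex_decomposable
    (dup (glue G H [fset u; v]) (glue_weight G k h)).
Proof.
set e := [fset u; v]; set L := dup _ _.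
suff dec : decomposing_sequence L (shadows (inl u) l).
  by split=> //; apply: decomposing_sequence_decomposable dec.
have [uvG _ _] := leafG; have [uvH _ _] := leafH.
have [_ _ u_v] := adj_vertices uvG.
have khe : k e = h e by rewrite ke he.
have cov : adj_cover dup_inl (dup_copy e) (dup G k) (dup H h) L.
  exact: adj_dup_glue.
(* Deleting shadows of [inl u] thus deletes exactly the shadows of [u] in the copy of [H]. *)
have copy_u t : (glue_copy e t == inl u) = (t == u).
  rewrite /glue_copy; case: ifP => // /negbT te; apply/esym/negbTE.
  by apply: contraNneq te => ->; apply: fset21.
have cov_Psi i : i <= l -> adj_cover dup_inl (dup_copy e)
    (Psi (dup G k) (shadows u l) i) (Psi (dup H h) (shadows u l) i)
    (Psi L (shadows (inl u) l) i).
  move=> il.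
  (* The successive deletions amount to removing the first [i] shadows at once, the form treated by
     [adj_cover_remove]. *)
  have adjE (C : choiceType) (F : graph (C * nat)%type) x :
      adj (remove F [fset a | a in shadows x i]) =2 adj (Psi F (shadows x l) i).
    by move=> a b; rewrite adj_remove adj_Psi take_shadows // !inE.
  apply: (eq_adj_cover (adjE _ _ _) (adjE _ _ _) (adjE _ _ _)).
  apply: adj_cover_remove => // [[t p]|[t p]] b _.
    by rewrite !inE !in_shadows.
  by rewrite !inE !in_shadows /= copy_u.
have [_ decGO decGl] := (decomposing_sequence_shadows _ _ _).1 decG.
have [_ decHO decHl] := (decomposing_sequence_shadows _ _ _).1 decH.
apply/decomposing_sequence_shadows; split.
(* [l - i] is the largest index adjacent to [i.+1], their sum being [l.+1]. A neighbour of index [p]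
   has [p <= i.+1] by the sum and [i < p] by the deletions. *)
- move=> i il; apply: (@shedding_pendant _ _ _ (inl v, l - i)).
    rewrite adj_Psi take_shadows ?(ltnW il) // !in_shadows /=.
    rewrite eqxx ltnn andbF /=.
    apply/andP; split; last by apply: contraNN u_v => /andP[/eqP[->]].
    have -> := adj_dup_glue_inl H k h (u, i.+1) (v, l - i) uvG.
    by rewrite adj_dup /= ke /adj uvG; lia.
  case=> A p; rewrite adj_Psi take_shadows ?(ltnW il) // !in_shadows /=.
  case/and3P=> /cov vA _ pi.
  suff [Au p0 ple] : [/\ A = inl u, 0 < p & p + (l - i) <= l.+1].
    by move: pi; rewrite Au eqxx /= => pi; congr (_, _); lia.
  (* The neighbour may come from either part; in both, [v] is the leaf vertex and [e] has weight
     [l]. *)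
  case: vA => [] [[t q] [[w q'] [[vt qE] [-> ->]]]].
    by rewrite -vt -qE => /(leaf_dup_adj leafG) /=; rewrite ke => -[-> ].
  have /glue_copy_inl[-> _] := esym vt; rewrite -qE.
  move=> /(leaf_dup_adj leafH) /=; rewrite he => -[-> p0 ple]; split=> //.
  by apply/eqP; rewrite copy_u.
- move=> i il; apply: vertex_decomposable_union (decGO i il) (decHO i il).
  + exact: dup_inl_inj.
  + exact: dup_copy_inj.
  (* The closed neighbourhood of [(inl u, i.+1)] pulls back to that of [(u, i.+1)] in each part. *)
  + apply: adj_cover_remove (cov_Psi _ (ltnW il)) _ _ => [a a' aa'|a a' aa'].
      rewrite !in_closed_nbhd (inj_eq (@dup_inl_inj K) a (u, i.+1)) !adj_Psi.
      rewrite (adj_dup_glue_inl H k h (u, i.+1) a uvG).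
      rewrite !take_shadows ?(ltnW il) //.
      by rewrite !in_shadows.
    (* The identified vertex is also the copy of the one from [H]. *)
    have <- : dup_copy e (u, i.+1) = (inl u, i.+1).
      by congr (_, _); apply/eqP; rewrite copy_u.
    rewrite !in_closed_nbhd (inj_eq (@dup_copy_inj _ _)) !adj_Psi.
    rewrite adj_dup_glue_copy // !take_shadows ?(ltnW il) //.
    by rewrite !in_shadows /= !copy_u.
  + apply: (leaf_separated (k := k) leafG) => [a b|p b].
      by rewrite adj_remove adj_Psi => /andP[/andP[]].
    exact: Omega_shadow_isolated.
- apply: vertex_decomposable_union decGl decHl.
  + exact: dup_inl_inj.
  + exact: dup_copy_inj.
  + exact: cov_Psi.
  + apply: (leaf_separated (k := k) leafG) => [a b|p [w q]].
      by rewrite adj_Psi => /andP[].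
    (* A remaining [(u, p)] has [l < p], so [p + q] exceeds [l.+1] for every [q >= 1], while all
       weights are at most [l]. *)
    rewrite adj_Psi take_shadows // adj_dup !in_shadows /= eqxx /=.
    apply/negP => /and3P[/and4P[uw p0 q0 pq]]; have := k_le _ uw.
    lia.
Qed.
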